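(* (i) If $r\in\{3,4\}$ and $n\ge 18$, then $t_2(n,r)\ge \frac{4}{3}n-24$. (ii) If $5\le r\le n-1$ and $n>\frac{1}{6}r(r-1)$, then $t_2(n,r)\ge \frac{6}{5}n-\frac{1}{5}r(r-1)$.
   Context: All graphs are finite, simple and undirected. An $r$-colouring of a graph $G$ is a function $c:E(G)\to\{1,\dots,r\}$ (not necessarily proper). A path is rainbow if all its edges have distinct colours. For a $2$-connected graph $G$, a colouring is rainbow $2$-connected if every two vertices of $G$ are connected by two internally vertex-disjoint rainbow paths, and the rainbow $2$-connection number $rc_2(G)$ is the minimum number of colours in a rainbow $2$-connected colouring of $G$. For integers $n$ and $r\ge 1$, $t_2(n,r)$ denotes the minimum number of edges in a $2$-connected graph $G$ on $n$ vertices with $rc_2(G)\le r$. *)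

(* Defs.v *)
From HB Require Import structures.
From mathcomp Require Import all_boot all_order all_algebra.

Set Implicit Arguments.
Unset Strict Implicit.
Unset Printing Implicit Defensive.

Record sgraph (T : finType) := SGraph {
  adj :> rel T;
  adj_sym : symmetric adj;
  adj_irr : irreflexive adj
}.

Definition edges (T : finType) (G : sgraph T) : {set {set T}} :=
  [set [set xy.1; xy.2] | xy in [set xy : T * T | G xy.1 xy.2]].

Definition connected (T : finType) (G : sgraph T) : Prop :=
  forall x y : T, connect G x y.

(* Adjacency in G - v; v is kept in the carrier as an isolated point. *)
Definition adj_del (T : finType) (G : sgraph T) (v : T) : rel T :=
  [rel x y | [&& G x y, x != v & y != v]].

Definition two_connected (T : finType) (G : sgraph T) : Prop :=
  [/\ 3 <= #|T|, connected G &
      forall v x y : T, x != v -> y != v -> connect (adj_del G v) x y].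

(* The path with vertex sequence x :: p, ending at y. *)
Definition is_path (T : finType) (G : sgraph T) (x y : T) (p : seq T) : bool :=
  [&& path G x p, last x p == y & uniq (x :: p)].

Definition internal (T : finType) (x : T) (p : seq T) : seq T :=
  behead (belast x p).

(* An r-colouring is a function c : {set T} -> 'I_r of which only the values on
   edges of G are ever used. *)
Definition path_colours (T : finType) (r : nat) (c : {set T} -> 'I_r)
    (x : T) (p : seq T) : seq 'I_r :=
  pairmap (fun a b => c [set a; b]) x p.

Definition rainbow_path (T : finType) (G : sgraph T) (r : nat)
    (c : {set T} -> 'I_r) (x y : T) (p : seq T) : bool :=
  is_path G x y p && uniq (path_colours c x p).

(* The condition p != q only matters for adjacent x, y: it prevents the path
   consisting of the single edge xy from being counted twice. *)
Definition rainbow_2connected (T : finType) (G : sgraph T) (r : nat)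
    (c : {set T} -> 'I_r) : Prop :=
  forall x y : T, x != y ->
    exists p q : seq T,
      [/\ rainbow_path G c x y p, rainbow_path G c x y q, p != q &
          [disjoint internal x p & internal x q]].

Definition is_min (P : nat -> Prop) (m : nat) : Prop :=
  P m /\ (forall k, P k -> m <= k).

(* is_rc2 G k means rc_2(G) = k. *)
Definition is_rc2 (T : finType) (G : sgraph T) (k : nat) : Prop :=
  is_min (fun r => exists c : {set T} -> 'I_r, rainbow_2connected G c) k.

(* is_t2 n r m means t_2(n, r) = m. *)
Definition is_t2 (n r m : nat) : Prop :=
  is_min (fun e => exists (T : finType) (G : sgraph T),
            [/\ #|T| = n, two_connected G,
                (exists2 k, is_rc2 G k & k <= r) & #|edges G| = e]) m.

(* Main.v *)
Require Import Defs.
From HB Require Import structures.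
From mathcomp Require Import all_boot all_order all_algebra zify lra.
From Stdlib Require Import Classical.

(** Every degree is at least 2, so for D the sum of the degrees that are at
    least 3 the sum of all degrees is 2 n_2 + D, n_2 counting the vertices of
    degree 2; the task is to bound n_2 from above.

    The two rainbow paths out of a vertex of degree 2 use both of its edges.
    Comparing the colours at the ends of such paths shows that an arc uv between
    vertices of degree 2 is determined, up to reversal, by the colours of the
    other edge at u and of uv, and these two colours differ. So there are at most
    2 r (r - 1) such arcs, whence 2 n_2 <= D + 2 r (r - 1), which gives (ii).

    For (i) recolour with r = 4 colours. Apart from at most 28 exceptions, a
    vertex of degree 2 has two edges of different colours and no neighbour of
    degree 2; call it plain and let it send charge 1/2 to both neighbours.  A
    vertex of degree d >= 4 may absorb d/2 <= 3d/2 - 4, and one of degree 3 may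
    absorb 1/2, so the excess is at most a quarter of the number of triples
    (w, u1, u2) with u1 <> u2 plain neighbours of w and deg w = 3.  The colours of
    the edges at u1 and u2 take only 84 values on triples.  Rainbow paths now have
    length at most 4, and this rules out three triples with the same colours. *)

Set Implicit Arguments.
Unset Strict Implicit.
Unset Printing Implicit Defensive.
Import Order.TTheory GRing.Theory Num.Theory.

(** * Cardinalities of fibres and of off-diagonal pairs *)

Lemma card_le2_imset (X Y : finType) (f : X -> Y) (A : {set X}) :
  (forall x y z, x \in A -> y \in A -> z \in A -> f x = f y -> f z = f y ->
     x != y -> y != z -> z != x -> False) ->
  #|A| <= 2 * #|f @: A|.
Proof.
move=> H; rewrite -sum1_card (partition_big_imset f) /= mulnC -sum_nat_const.
apply: leq_sum => b _; rewrite sum1dep_card leqNgt.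
apply/negP => /card_gt2P[x [y [z [[]]]]].
rewrite !inE => /andP[xA /eqP fx] /andP[yA /eqP fy] /andP[zA /eqP fz] [xy yz zx].
by apply: (H x y z); rewrite ?fx ?fy ?fz.
Qed.

Lemma card_offdiag (X : finType) (S : {set X}) :
  #|[set q : X * X | [&& q.1 \in S, q.2 \in S & q.1 != q.2]]| + #|S| = #|S| * #|S|.
Proof.
rewrite -cardsX -(card_imset S (f := fun x => (x, x))); last by move=> x y [].
rewrite -cardsUI [X in _ + X](_ : _ = 0) ?addn0; last first.
  apply/eqP; rewrite cards_eq0; apply/eqP/setP => -[x y]; rewrite !inE /=.
  by apply/negP => /andP[/and3P[_ _ /negP ne] /imsetP[t _ [ex ey]]]; apply: ne; rewrite ex ey.
apply: eq_card => -[x y]; rewrite !inE /=.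
case: (eqVneq x y) => [<-|ne] /=; rewrite ?andbF ?andbT /= ?andbb.
  by apply/imsetP/idP => [[t tS [->]]//|xS]; exists x.
case: imsetP => [[t _ [ex ey]]|_]; last by rewrite orbF.
by move: ne; rewrite ex ey eqxx.
Qed.

(** * Rainbow paths at vertices of degree 2, for any number of colours *)

Section Rainbow.
Variables (T : finType) (G : sgraph T) (r : nat) (c : {set T} -> 'I_r).
Hypothesis H : rainbow_2connected G c.

Local Notation col x y := (c [set x; y]).
Local Notation rbp := (rainbow_path G c).

Definition deg (x : T) := #|[set y | G x y]|.

Definition nbr2 (u x y : T) : Prop := x != y /\ forall t, G u t = (t == x) || (t == y).

Lemma colC x y : col x y = col y x.
Proof. by rewrite setUC. Qed.

Lemma adj_neq x y : G x y -> x != y.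
Proof. by move=> Gxy; apply/eqP => e; move: Gxy; rewrite e adj_irr. Qed.

Lemma nbr2C u x y : nbr2 u x y -> nbr2 u y x.
Proof. by move=> [ne N]; split; [rewrite eq_sym | move=> t; rewrite N orbC]. Qed.

Lemma nbr2_deg u x y : nbr2 u x y -> deg u = 2.
Proof.
case=> ne N; rewrite /deg (_ : [set t | G u t] = [set x; y]) ?cards2 ?ne //.
by apply/setP => t; rewrite !inE N.
Qed.

Lemma deg_nbr2 u x : deg u = 2 -> G u x -> exists y, nbr2 u x y.
Proof.
rewrite /deg => /eqP /cards2P[a [b [ne E]]] Gux.
have N t : G u t = (t == a) || (t == b) by move/setP: E => /(_ t); rewrite !inE.
move: Gux; rewrite N => /orP[]/eqP->; first by exists b; split.
by exists a; apply: nbr2C; split.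
Qed.

Lemma nbr2_l u x y : nbr2 u x y -> G u x.
Proof. by case=> _ ->; rewrite eqxx. Qed.

Lemma nbr2_r u x y : nbr2 u x y -> G u y.
Proof. by case=> _ ->; rewrite eqxx orbT. Qed.

Lemma nbr2_in u x y t : nbr2 u x y -> G u t -> t = x \/ t = y.
Proof. by case=> _ -> /orP[]/eqP; [left|right]. Qed.

Lemma rainbow_nil x y : rbp x y [::] = (x == y).
Proof. by rewrite /rainbow_path /is_path /= !andbT. Qed.

Lemma rainbow_cons x y f p : rbp x y (f :: p) =
  [&& G x f, x \notin f :: p, col x f \notin path_colours c f p & rbp f y p].
Proof.
rewrite /rainbow_path /is_path /=.
case: (G x f) => //=; case: (x \notin f :: p); rewrite ?andbF //=.
by case: (_ \notin path_colours c f p); rewrite ?andbF //=.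
Qed.

Lemma rainbow_self x p : rbp x x p -> p = [::].
Proof.
case: p => // f p; rewrite rainbow_cons => /and4P[_ /negP nx _ /andP[/and3P[_ /eqP l _] _]].
by case: nx; rewrite -l mem_last.
Qed.

Lemma rainbow_size x y p : rbp x y p -> size p <= r.
Proof.
case/andP=> _ /card_uniqP; rewrite size_pairmap => <-.
by rewrite -[X in _ <= X](card_ord r) max_card.
Qed.

(** A common first vertex would be [y]; both paths would then be the single edge [x y], against
    [p != q]. *)
Lemma two_paths x y : x != y -> exists f p g q,
  [/\ rbp x y (f :: p), rbp x y (g :: q), f != g &
      forall t, t \in f :: p -> t \in g :: q -> t = y].
Proof.
move=> ne; have [[|f p] [[|g q] [Hp Hq pq D]]] := H ne;
  rewrite ?rainbow_nil ?(negPf ne) // in Hp Hq.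
have lst h s : rbp x y (h :: s) -> last h s = y by case/andP=> /and3P[_ /eqP].
have E t : t \in f :: p -> t \in g :: q -> t = y.
  rewrite (lastI f) (lastI g) (lst _ _ Hp) (lst _ _ Hq) !mem_rcons !inE.
  case/orP=> [/eqP //|tp]; case/orP=> [/eqP //|tq].
  by move/disjointFr: D => /(_ t tp); rewrite /internal /= tq.
exists f, p, g, q; split=> //; apply/eqP => fg.
have fy : f = y by apply: E; rewrite ?fg mem_head.
move: Hp Hq pq; rewrite !rainbow_cons -fg fy => /and4P[_ _ _ /rainbow_self->].
by case/and4P=> _ _ _ /rainbow_self->; rewrite eqxx.
Qed.

Lemma deg_ge2 x y : x != y -> 2 <= deg x.
Proof.
move=> /two_paths[f [p [g [q []]]]]; rewrite !rainbow_cons => /andP[xf _] /andP[xg _] fg _.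
by apply/card_gt1P; exists f, g; split=> //; rewrite inE.
Qed.

Lemma start2 u x y t : nbr2 u x y -> u != t -> exists p q,
  [/\ rbp u t (x :: p), rbp u t (y :: q) &
      forall s, s \in x :: p -> s \in y :: q -> s = t].
Proof.
move=> N /two_paths[f [p [g [q [Rp Rq fg D]]]]].
have [Gf Gg] : G u f /\ G u g by move: Rp Rq; rewrite !rainbow_cons => /andP[? _] /andP[? _].
case: (nbr2_in N Gf) (nbr2_in N Gg) => ? [] ?; subst f g; move: fg; rewrite ?eqxx // => _.
  by exists p, q.
by exists q, p; split=> // s s1 s2; apply: D.
Qed.

Lemma last_edge x y p : rbp x y p -> x != y -> exists t,
  [/\ t \in x :: p, G t y & col t y \in path_colours c x p].
Proof.
elim: p x => [|f p IH] x; first by rewrite rainbow_nil => ->.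
rewrite rainbow_cons => /and4P[Gxf _ _ Rf] ne.
case: (eqVneq f y) => [fy|fy].
  by subst f; exists x; rewrite !mem_head.
have [t [tin Gt ct]] := IH _ Rf fy; exists t; split=> //; first by rewrite inE tin orbT.
by rewrite /= inE ct orbT.
Qed.

(** The vertex [t] precedes [y]; since [f != y], the last edge comes strictly after the first
    one. *)
Lemma last_edge1 x y f p : rbp x y (f :: p) -> f != y -> exists t,
  [/\ t \in f :: p, G t y, t != x & col t y != col x f].
Proof.
rewrite rainbow_cons => /and4P[_ xn cn Rf] fy; have [t [tin Gt ct]] := last_edge Rf fy.
exists t; split=> //; first by apply: contraNneq xn => <-.
by apply: contraNneq cn => <-.
Qed.

Lemma through2 x y f g p : rbp x y (f :: p) -> f != y -> nbr2 f x g ->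
  exists2 p', p = g :: p' & col x f != col f g.
Proof.
rewrite rainbow_cons => /and4P[_ xn cn Rf] fy N.
case: p xn cn Rf => [|h p xn cn]; first by rewrite rainbow_nil (negPf fy).
rewrite rainbow_cons => /andP[Gfh _].
case: (nbr2_in N Gfh) => eh; subst h; first by move: xn; rewrite !inE eqxx orbT.
by exists p => //; apply: contraNneq cn => ->; rewrite mem_head.
Qed.

Lemma through2_last x y f g p : rbp x y (f :: p) -> f != y -> nbr2 f x g -> g != y ->
  exists t, [/\ G t y, t != x, col t y != col x f & col t y != col f g].
Proof.
move=> R fy N gy; have [p' e _] := through2 R fy N; subst p.
move: R; rewrite !rainbow_cons => /and4P[_ xn xc /and4P[_ _ fc Rg]].
have [t [tin Gt ct]] := last_edge Rg gy.
exists t; split=> //.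
- by apply: contraNneq xn => <-; rewrite inE tin orbT.
- by apply: contraNneq xc => <-; rewrite inE ct orbT.
- by apply: contraNneq fc => <-.
Qed.

(** One of the two paths from [v] to [x] starts with [u], from where it can only go on to [x]; it
    contains both edges. *)
Lemma deg2_deg2_col u v x : nbr2 u v x -> deg v = 2 -> col x u != col u v.
Proof.
move=> N dv; have [w Nv] : exists w, nbr2 v u w.
  by apply: deg_nbr2 => //; rewrite adj_sym; apply: nbr2_l N.
have [p [q [R _ _]]] := start2 Nv (N.1 : v != x).
have [_ _] := through2 R (adj_neq (nbr2_r N)) N.
by rewrite eq_sym (colC v) (colC x).
Qed.

(** Both edges at [u] have one colour, so a path to [u] that starts along [u' x'] would repeat it on
    its last edge. *)
Lemma mono_unique u x y u' x' : nbr2 u x y -> col u x = col u y -> deg u' = 2 -> G u' x' ->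
  col u' x' = col u x -> u' = u.
Proof.
move=> N e du' Gu e'; apply/eqP; apply: contraT => ne.
have [y' N'] := deg_nbr2 du' Gu.
have Dx v : G u v -> deg v != 2.
  move=> Guv; apply/eqP => dv.
  case: (nbr2_in N Guv) => ev; subst v.
    by have := deg2_deg2_col N dv; rewrite colC e eqxx.
  by have := deg2_deg2_col (nbr2C N) dv; rewrite colC e eqxx.
have [p [q [R _ _]]] := start2 N' ne.
have x'u : x' != u.
  by apply/eqP => ex; subst x'; have := Dx u'; rewrite adj_sym du' => /(_ Gu).
have [t [_ Gt _]] := last_edge1 R x'u.
rewrite adj_sym in Gt; rewrite colC e'.
by case: (nbr2_in N Gt) => ->; rewrite -?e eqxx.
Qed.

(* Comparing end colours leaves only one other possibility, a thread v' u' u v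
   coloured b, a, b, which no rainbow path from v' to v can traverse. *)
Lemma arc_inj u v x w u' v' x' w' : nbr2 u v x -> nbr2 v u w ->
  nbr2 u' v' x' -> nbr2 v' u' w' ->
  col x u = col x' u' -> col u v = col u' v' ->
  (u' = u /\ v' = v) \/ (u' = v /\ v' = u).
Proof.
move=> Nu Nv Nu' Nv' ea eb.
have ab := deg2_deg2_col Nu (nbr2_deg Nv).
case: (eqVneq v' u) => [e|v'u].
  subst v'; have Gu : G u u' := nbr2_l Nv'.
  case: (nbr2_in Nu Gu) => e; subst u'; first by right.
  by move: ab; rewrite eb eqxx.
have [p [q [R _ _]]] := start2 Nv' v'u.
case: (eqVneq u' u) => [e|u'u].
  subst u'; case: (nbr2_in Nu (nbr2_l Nu')) => e; first by left.
  by subst v'; move: ab; rewrite eb colC eqxx.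
(* If [x' != u], the path passes [v' u' x'] and so uses both colours found at [u] before its last
   edge. *)
case: (eqVneq x' u) => [e|x'u]; last first.
  have [t [Gt tv c1 c2]] := through2_last R u'u Nu' x'u.
  rewrite adj_sym in Gt; case: (nbr2_in Nu Gt) => e; subst t.
    by move: c1; rewrite colC eb colC eqxx.
  by move: c2; rewrite ea colC eqxx.
subst x'; have Gu : G u u' by rewrite adj_sym; apply: nbr2_r Nu'.
case: (nbr2_in Nu Gu) => e; subst u'; first by move: ab; rewrite ea eqxx.
case: (eqVneq v' v) => [e|v'v].
  subst v'; case: (nbr2_in Nv' (nbr2_l Nv)) => e; first by rewrite e eqxx in u'u.
  by subst w'; have := deg2_deg2_col Nv' (nbr2_deg Nu'); rewrite eb colC eqxx.
have [p1 [q1 [R1 _ _]]] := start2 Nv' v'v.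
have xv : x != v by rewrite eq_sym Nu.1.
have [p2 e _] := through2 R1 xv Nu'; subst p1.
move: R1; rewrite rainbow_cons => /and4P[_ _ cn R1].
have [p3 e _] := through2 R1 (adj_neq (nbr2_l Nu)) (nbr2C Nu); subst p2.
by move: cn; rewrite /= !inE (colC v') -eb eqxx orbT.
Qed.

End Rainbow.

Section FourColours.
Variables (T : finType) (G : sgraph T) (c : {set T} -> 'I_4).
Hypothesis H : rainbow_2connected G c.

Local Notation col x y := (c [set x; y]).
Local Notation rbp := (rainbow_path G c).

(* In the notation of a configuration: w has neighbours u1, u2, z, and u_i has
   neighbours w, y_i. The colours a_i of w u_i, b_i of u_i y_i and g of w z are
   named ca1, cb1, ... below. *)
Record config := Config {
  cw : T; cu1 : T; cu2 : T; cz : T; cy1 : T; cy2 : T;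
  cNw : forall t, G cw t = [|| t == cu1, t == cu2 | t == cz];
  cN1 : nbr2 G cu1 cw cy1;
  cN2 : nbr2 G cu2 cw cy2;
  cu12 : cu1 != cu2;
  cdw : 2 < deg G cw;
  cdy1 : 2 < deg G cy1;
  cdy2 : 2 < deg G cy2;
  cab1 : col cw cu1 != col cu1 cy1;
  cab2 : col cw cu2 != col cu2 cy2 }.

(** Transparent, so that projections of a swapped configuration reduce and facts about index 1 give
    those about index 2 by conversion. *)
Definition cswap (K : config) : config.
Proof.
refine (@Config (cw K) (cu2 K) (cu1 K) (cz K) (cy2 K) (cy1 K) _
  (cN2 K) (cN1 K) _ (cdw K) (cdy2 K) (cdy1 K) (cab2 K) (cab1 K)).
- by move=> t; rewrite cNw orbCA.
- by rewrite eq_sym cu12.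
Defined.

Definition ca1 K := col (cw K) (cu1 K).
Definition ca2 K := col (cw K) (cu2 K).
Definition cb1 K := col (cu1 K) (cy1 K).
Definition cb2 K := col (cu2 K) (cy2 K).
Definition cg K := col (cw K) (cz K).

Definition ctype (K : config) := (ca1 K, cb1 K, ca2 K, cb2 K).

Lemma ctypeE K K' : ctype K = ctype K' ->
  [/\ ca1 K = ca1 K', cb1 K = cb1 K', ca2 K = ca2 K' & cb2 K = cb2 K'].
Proof. by case. Qed.

Lemma ctype_swap K K' : ctype K = ctype K' -> ctype (cswap K) = ctype (cswap K').
Proof. by move/ctypeE=> [e1 e2 e3 e4]; congr (_, _, _, _). Qed.

Lemma deg_neq x u : 2 < deg G x -> deg G u = 2 -> x != u.
Proof. by move=> dx du; apply: contraTneq dx => ->; rewrite du. Qed.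

Lemma cdu1 K : deg G (cu1 K) = 2. Proof. exact: nbr2_deg (cN1 K). Qed.
Lemma cdu2 K : deg G (cu2 K) = 2. Proof. exact: nbr2_deg (cN2 K). Qed.

Lemma ca1C K : col (cu1 K) (cw K) = ca1 K. Proof. exact: colC. Qed.
Lemma cb1C K : col (cy1 K) (cu1 K) = cb1 K. Proof. exact: colC. Qed.
Lemma cb2C K : col (cy2 K) (cu2 K) = cb2 K. Proof. exact: colC. Qed.

(** Of the two paths from [u1] to [u2], one leaves and arrives through [w], the other leaves through
    [y1] and arrives through [y2]. *)
Lemma config_col K : ca1 K != ca2 K /\ cb1 K != cb2 K.
Proof.
have [p [q [RP RQ D]]] := start2 H (cN1 K) (cu12 K).
have wu2 := deg_neq (cdw K) (cdu2 K).
have y1u2 := deg_neq (cdy1 K) (cdu2 K).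
have y2u2 := deg_neq (cdy2 K) (cdu2 K).
have [t [tP Gt _ ct]] := last_edge1 RP wu2.
have [s [sQ Gs _ cs]] := last_edge1 RQ y1u2.
rewrite adj_sym in Gt; rewrite adj_sym in Gs.
case: (nbr2_in (cN2 K) Gs) => es; subst s.
  by have := D _ (mem_head _ _) sQ => e; rewrite e eqxx in wu2.
case: (nbr2_in (cN2 K) Gt) => et; subst t; last first.
  by have := D _ tP sQ => e; rewrite e eqxx in y2u2.
by rewrite -[ca1 K]ca1C eq_sym ct -cb2C eq_sym cs.
Qed.

(** * Two configurations of equal type with distinct centres; primed letters belong to [K'] *)

Section Pair.
Variables K K' : config.
Hypotheses (ne : cw K != cw K') (S : ctype K = ctype K').

Lemma pair_u1 : cu1 K != cu1 K'.
Proof.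
apply/eqP => e; have [ea _ _ _] := ctypeE S.
have := nbr2_l (cN1 K'); rewrite -e => /(nbr2_in (cN1 K))[e1|e1].
  by move: ne; rewrite e1 eqxx.
by have := cab1 K; rewrite -/(ca1 K) ea /ca1 -e e1 colC eqxx.
Qed.

(** The edge [w' u1'] has colour [a1], so any other colour means arrival from [y1']. The separate
    [f] serves both orientations of an edge. *)
Lemma pair_last1 t f : G t (cu1 K') -> col t (cu1 K') != f -> f = ca1 K -> t = cy1 K'.
Proof.
have [ea _ _ _] := ctypeE S.
rewrite adj_sym => /(nbr2_in (cN1 K'))[] -> //.
by rewrite -/(ca1 K') -ea => /eqP h e; case: h.
Qed.

(** The path from [u1] through [w] enters [u1'] from [y1'], the other one contains [y1], and they
    meet only at [u1']. *)
Lemma pair_y1 : cy1 K != cy1 K'.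
Proof.
have [p [q [RP RQ D]]] := start2 H (cN1 K) pair_u1.
have [t [tP Gt _ ct]] := last_edge1 RP (deg_neq (cdw K) (cdu1 K')).
have et := pair_last1 Gt ct (ca1C K); subst t.
apply/eqP => e; have := D _ tP; rewrite -e mem_head => /(_ isT) e1.
by have := deg_neq (cdy1 K) (cdu1 K'); rewrite e1 eqxx.
Qed.

(** Its first two edges would use up [a1] and [b1], the only colours at [u1']. *)
Lemma pair_not_start1 p : ~ rbp (cw K) (cu1 K') (cu1 K :: p).
Proof.
move=> R; have [ea eb _ _] := ctypeE S.
have [t [Gt _ c1 c2]] := through2_last R pair_u1 (cN1 K) (deg_neq (cdy1 K) (cdu1 K')).
have et := pair_last1 Gt c1 (erefl _); subst t.
by move: c2; rewrite cb1C -eb eqxx.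
Qed.

(** Two of the three neighbours of [w] start rainbow paths to [u1'], and [u1] is not one of them. *)
Lemma pair_start2 : exists p, rbp (cw K) (cu1 K') (cu2 K :: p).
Proof.
have [f [p [g [q [Rp Rq fg _]]]]] := two_paths H (deg_neq (cdw K) (cdu1 K')).
have [Gf Gg] : G (cw K) f /\ G (cw K) g.
  by move: Rp Rq; rewrite !rainbow_cons => /andP[? _] /andP[? _].
move: Gf Gg; rewrite !cNw => /or3P[]/eqP ef; subst f.
- by case: (pair_not_start1 Rp).
- by exists p.
case/or3P=> /eqP eg; subst g.
- by case: (pair_not_start1 Rq).
- by exists q.
- by rewrite eqxx in fg.
Qed.

(** The path starting [w u2 y2] has at most four edges, so the vertex [t] before [u1'] is [y2] or
    adjacent to it. *)
Lemma pair_route : cu2 K != cu1 K' -> exists t,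
  [/\ G (cu1 K') t, t != cw K, col t (cu1 K') != ca2 K, col t (cu1 K') != cb2 K &
    t = cy2 K \/ [/\ G (cy2 K) t, col (cy2 K) t != ca2 K, col (cy2 K) t != cb2 K &
                     col (cy2 K) t != col t (cu1 K')]].
Proof.
move=> u21; have [p R] := pair_start2.
have y2u := deg_neq (cdy2 K) (cdu1 K').
have sz := rainbow_size R.
have [q e _] := through2 R u21 (cN2 K); subst p.
case: q R sz => [|a [|b [|? ?]]] //; rewrite !rainbow_cons !rainbow_nil /= ?inE ?negb_or.
- by rewrite (negPf y2u) !andbF.
- case/and4P=> _ /and3P[_ wy _] /andP[c1 c2] /and4P[_ _ c3 /and3P[Ga _ /eqP ea]] _.
  subst a; exists (cy2 K); split; rewrite 1?eq_sym ?c3 //; first by rewrite adj_sym.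
  by left.
case/and4P=> _ /and4P[_ _ wa _] /and3P[c1 c2 c3] /and4P[_ _ /andP[c4 c5]].
case/and4P=> Ga _ c6 /and3P[Gb _ /eqP eb] _; subst b.
exists a; split; rewrite 1?eq_sym //; first by rewrite adj_sym.
by right; split; rewrite // eq_sym.
Qed.

(** In the first case [u2], in the second [y2], is a neighbour of [w'] other than [u1'] and [u2'],
    hence [z']. *)
Lemma pair_route_w t : t = cw K' ->
  t = cy2 K \/ [/\ G (cy2 K) t, col (cy2 K) t != ca2 K, col (cy2 K) t != cb2 K &
                     col (cy2 K) t != col t (cu1 K')] ->
  cu2 K != cu1 K' -> cu2 K != cu2 K' ->
  (cz K' = cu2 K /\ cy2 K = cw K') \/
  [/\ cz K' = cy2 K, cg K' != ca1 K, cg K' != ca2 K & cg K' != cb2 K].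
Proof.
move=> -> [e|[Gy c1 c2 c3]] n1 n2.
  have : G (cw K') (cu2 K) by rewrite e adj_sym; apply: nbr2_r (cN2 K).
  by rewrite cNw (negPf n1) (negPf n2) => /eqP->; left.
have : G (cw K') (cy2 K) by rewrite adj_sym.
rewrite cNw (negPf (deg_neq (cdy2 K) (cdu1 K'))) (negPf (deg_neq (cdy2 K) (cdu2 K'))).
move/eqP=> e; right; have [ea _ _ _] := ctypeE S.
by rewrite /cg -e colC; split=> //; rewrite ea.
Qed.

End Pair.

Lemma pair_u2 K K' : cw K != cw K' -> ctype K = ctype K' -> cu2 K != cu2 K'.
Proof. by move=> ne /ctype_swap S; apply: (@pair_u1 (cswap K) (cswap K')). Qed.

Lemma pair_y2 K K' : cw K != cw K' -> ctype K = ctype K' -> cy2 K != cy2 K'.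
Proof. by move=> ne /ctype_swap S; apply: (@pair_y1 (cswap K) (cswap K')). Qed.

(** The route cannot arrive from [y1'], as that edge has colour [b1 = a2]; it arrives from [w'] with
    colour [a1], so [a1 != b2]. Conversely, [u2 = u1'] makes [w' = y2] and [a1 = b2]. *)
Lemma pair_a2b1 K K' : cw K != cw K' -> ctype K = ctype K' -> ca2 K = cb1 K ->
  if ca1 K == cb2 K then cu2 K = cu1 K' else cz K' = cu2 K \/ cz K' = cy2 K.
Proof.
move=> ne S ab; have [ea eb ea2 eb2] := ctypeE S.
case: (eqVneq (cu2 K) (cu1 K')) => u21.
  case: ifP => // /eqP[].
  have := nbr2_l (cN2 K); rewrite u21 => /(nbr2_in (cN1 K'))[e|e].
    by rewrite e eqxx in ne.
  have := nbr2_l (cN1 K'); rewrite -u21 => /(nbr2_in (cN2 K))[e'|e'].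
    by rewrite e' eqxx in ne.
  by rewrite ea /ca1 /cb2 u21 e' colC.
have [t [Gt tw c1 c2 Ht]] := pair_route ne S u21.
have et : t = cw K'.
  case: (nbr2_in (cN1 K') Gt) => // et; subst t.
  by move: c1; rewrite cb1C -eb ab eqxx.
have := pair_route_w S et Ht u21 (pair_u2 ne S).
case: ifP => [/eqP e|_]; last by case=> [[->]|[->]]; [left|right].
by move: c2; rewrite et -/(ca1 K') -ea e eqxx.
Qed.

(** By [pair_a2b1] one vertex of [K2] coincides with a vertex of [K1] and one of [K3], which
    [pair_u2], [pair_y2] or the degrees forbid. *)
Lemma three_a2b1 K1 K2 K3 : cw K1 != cw K2 -> cw K3 != cw K2 -> cw K1 != cw K3 ->
  ctype K1 = ctype K2 -> ctype K3 = ctype K2 -> ca2 K1 = cb1 K1 -> False.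
Proof.
move=> n12 n32 n13 S12 S32 ab.
have S13 : ctype K1 = ctype K3 by rewrite S12.
have [ea eb ea2 eb2] := ctypeE S13.
have := pair_a2b1 n12 S12 ab; have := pair_a2b1 n32 S32; rewrite -ea -eb -ea2 -eb2.
move/(_ ab); have u2 := pair_u2 n13 S13; have y2 := pair_y2 n13 S13.
case: ifP => _; first by move=> <- e; rewrite e eqxx in u2.
case=> -> [] e.
- by rewrite e eqxx in u2.
- by have := deg_neq (cdy2 K1) (cdu2 K3); rewrite e eqxx.
- by have := deg_neq (cdy2 K3) (cdu2 K1); rewrite e eqxx.
- by rewrite e eqxx in y2.
Qed.

(** The path from [u1] through [w] has first colour [a1] and last colour [b1], so it avoids the edge
    [w z]. Having at most four edges, it is [u1 w u1'] or [u1 w u2 y2 u1']. *)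
Lemma pair_class1 K K' : cw K != cw K' -> ctype K = ctype K' ->
  (cg K == ca1 K) || (cg K == cb1 K) -> cy1 K' = cy2 K \/ cy1 K' = cw K.
Proof.
move=> ne S cl; have [ea eb ea2 eb2] := ctypeE S.
have [p [q [R _ _]]] := start2 H (cN1 K) (pair_u1 ne S).
have wu := deg_neq (cdw K) (cdu1 K').
have sz := rainbow_size R.
case: p R sz => [|s [|t [|v [|? ?]]]] //; rewrite !rainbow_cons !rainbow_nil /= ?inE ?negb_or.
- by rewrite (negPf wu) !andbF.
- case/and4P=> _ _ c1 /and3P[Gs _ /eqP es] _; subst s.
  by right; rewrite (pair_last1 S Gs _ (ca1C K)) // eq_sym.
- case/and4P=> _ /and3P[_ us _] /andP[c1 c2] /and4P[Gs _ c3 /and3P[Gt _ /eqP et]] _; subst t.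
  have es : s = cy1 K' by apply: (pair_last1 S Gt _ (ca1C K)); rewrite eq_sym.
  move: Gs; rewrite cNw => /or3P[]/eqP e.
  + by rewrite e eqxx in us.
  + by have := deg_neq (cdy1 K') (cdu2 K); rewrite -es e eqxx.
  + move: cl; rewrite /cg -e -[ca1 K]ca1C [_ == col _ (cw K)]eq_sym (negPf c1) /=.
    by rewrite eb -cb1C -es (negPf c3).
case/and4P=> _ /and4P[_ us ut _] /and3P[c1 c2 c3] /and4P[Gs].
case/and3P=> ws wt _ /andP[c4 c5] /and4P[Gt _ _ /and3P[Gv _ /eqP ev]] _; subst v.
have et : t = cy1 K' by apply: (pair_last1 S Gv _ (ca1C K)); rewrite eq_sym.
move: Gs; rewrite cNw => /or3P[]/eqP e.
- by rewrite e eqxx in us.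
- left; rewrite -et; subst s; case: (nbr2_in (cN2 K) Gt) => // e.
  by rewrite e eqxx in wt.
- move: cl; rewrite /cg -e -[ca1 K]ca1C [_ == col _ (cw K)]eq_sym (negPf c1) /=.
  by rewrite eb -cb1C -et (negPf c5).
Qed.

(** If [u1'] were [u2], its edge to [w = y1'] would have both colours [a2] and [b1]; hence
    [u1' = z]. The route of [pair_route] does not arrive from [w], so it arrives from [w']. *)
Lemma pair_y1w K K' : cw K != cw K' -> ctype K = ctype K' -> ca2 K != cb1 K ->
  cy1 K' = cw K -> [/\ cz K = cu1 K', cg K = cb1 K &
  (cz K' = cu2 K /\ cy2 K = cw K') \/
  [/\ cz K' = cy2 K, cg K' != ca1 K, cg K' != ca2 K & cg K' != cb2 K]].
Proof.
move=> ne S ab e; have [ea eb ea2 eb2] := ctypeE S.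
have : G (cw K) (cu1 K') by rewrite -e adj_sym; apply: nbr2_r (cN1 K').
have u21 : cu2 K != cu1 K'.
  apply: contraNneq ab => e1.
  by rewrite eb /ca2 /cb1 e1 e colC.
rewrite cNw eq_sym (negPf (pair_u1 ne S)) eq_sym (negPf u21) /= => /eqP ez.
split=> //; first by rewrite eb /cg /cb1 -ez e colC.
have [t [Gt tw c1 c2 Ht]] := pair_route ne S u21.
have et : t = cw K'.
  by case: (nbr2_in (cN1 K') Gt) => // et; rewrite et e eqxx in tw.
exact: (pair_route_w S et Ht u21 (pair_u2 ne S)).
Qed.

Lemma I4_exhaust (a b x y z : 'I_4) : uniq [:: a; b; x; y] -> z != a -> z != b -> z != x -> z = y.
Proof.
move=> u za zb zx; apply/eqP; apply: contraT => zy.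
have : uniq [:: z; a; b; x; y] by rewrite cons_uniq u !inE !negb_or za zb zx zy.
by move/card_uniqP => e; have := max_card (mem [:: z; a; b; x; y]); rewrite e card_ord.
Qed.

(** The four colours of the type are distinct here. By [pair_y1w], [K3] has [g = b2], and then its
    swap is compared with that of [K2], or only [g = b1] is left, and then [K3] is compared with
    both others. *)
Lemma three_mixed K1 K2 K3 : cw K1 != cw K2 -> cw K3 != cw K2 -> cw K1 != cw K3 ->
  ctype K1 = ctype K2 -> ctype K3 = ctype K2 -> ca2 K1 != cb1 K1 -> ca1 K1 != cb2 K1 ->
  cy1 K2 = cy2 K1 -> cy1 K3 = cw K1 -> False.
Proof.
move=> n12 n32 n13 S12 S32 ab ab' e2 e3.
have S13 : ctype K1 = ctype K3 by rewrite S12.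
have S31 := esym S13; have n31 : cw K3 != cw K1 by rewrite eq_sym.
have [ea eb ea2 eb2] := ctypeE S13.
have [na nb] := config_col K1.
have [ez eg [[z3 y2]|[z3 g1 g2 g3]]] := pair_y1w n13 S13 ab e3.
  have cl : (cg (cswap K3) == ca1 (cswap K3)) || (cg (cswap K3) == cb1 (cswap K3)).
    apply/orP; right; apply/eqP.
    by rewrite /cg /cb1 /= z3 -y2 cb2C eb2.
  have [e|/= e] := @pair_class1 (cswap K3) (cswap K2) n32 (ctype_swap S32) cl; last first.
    by have := pair_y2 n12 S12; rewrite y2 e eqxx.
  move: e; rewrite /= e3 => e.
  (* Now [cu2 K2] is joined to [cw K1] in colour [b2]; there the edges to [u1] and [z] have colours
     [a1] and [b1], and [pair_u2] excludes [u2]. *)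
  have : G (cw K1) (cu2 K2) by rewrite -e adj_sym; apply: nbr2_r (cN2 K2).
  have cc : col (cw K1) (cu2 K2) = cb2 K1.
    by rewrite -e cb2C; have [_ _ _ ->] := ctypeE S12.
  rewrite cNw => /or3P[]/eqP e'.
  - by move: ab'; rewrite -cc e' eqxx.
  - by have := pair_u2 n12 S12; rewrite e' eqxx.
  - by move: nb; rewrite -cc e' -eg eqxx.
have g : cg K3 = cb1 K3.
  rewrite -eb; apply: (@I4_exhaust (ca1 K1) (ca2 K1) (cb2 K1)) => //.
  rewrite /= !inE !negb_or na ab' ab cab1 [cb2 K1 == _]eq_sym nb.
  by have := cab2 K1 => /= ->.
have cl : (cg K3 == ca1 K3) || (cg K3 == cb1 K3) by rewrite g eqxx orbT.
have ab3 : ca2 K3 != cb1 K3 by rewrite -ea2 -eb.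
(* The alternative [cy1 K = cw K3] would make [cz K3], which is [cy2 K1], a vertex of degree 2. *)
have E K : cw K3 != cw K -> ctype K3 = ctype K -> cy1 K = cy2 K3.
  move=> n S; case: (pair_class1 n S cl) => // e.
  have [e' _ _] := pair_y1w n S ab3 e.
  by have := deg_neq (cdy2 K1) (cdu1 K); rewrite -z3 e' eqxx.
by have := pair_y1 n12 S12; rewrite (E _ n31 S31) (E _ n32 S32) eqxx.
Qed.

(** The vertices [y1] of [K2] and [K3] are distinct and each is [y2] or [w] of [K1], so each value
    occurs once. *)
Lemma three_class1 K1 K2 K3 : cw K1 != cw K2 -> cw K3 != cw K2 -> cw K1 != cw K3 ->
  ctype K1 = ctype K2 -> ctype K3 = ctype K2 -> ca2 K1 != cb1 K1 -> ca1 K1 != cb2 K1 ->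
  (cg K1 == ca1 K1) || (cg K1 == cb1 K1) -> False.
Proof.
move=> n12 n32 n13 S12 S32 ab ab' cl.
have S13 : ctype K1 = ctype K3 by rewrite S12.
have n23 : cw K2 != cw K3 by rewrite eq_sym.
have S23 := esym S32.
have y23 := pair_y1 n23 S23.
case: (pair_class1 n12 S12 cl) (pair_class1 n13 S13 cl) => e [] e'.
- by rewrite e e' eqxx in y23.
- exact: (@three_mixed K1 K2 K3).
- exact: (@three_mixed K1 K3 K2).
- by rewrite e e' eqxx in y23.
Qed.

(* Either a2 = b1 or a1 = b2 (equivalent under swapping u1 and u2), or the four
   colours of the type are all the colours, so g is one of them; up to the same
   swap, g is a1 or b1. *)
Lemma no_three K1 K2 K3 : cw K1 != cw K2 -> cw K3 != cw K2 -> cw K1 != cw K3 ->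
  ctype K1 = ctype K2 -> ctype K3 = ctype K2 -> False.
Proof.
move=> n12 n32 n13 S12 S32.
case: (eqVneq (ca2 K1) (cb1 K1)) => ab; first exact: (three_a2b1 n12 n32 n13 S12 S32 ab).
case: (eqVneq (ca1 K1) (cb2 K1)) => ab'.
  exact: (@three_a2b1 (cswap K1) (cswap K2) (cswap K3) n12 n32 n13
    (ctype_swap S12) (ctype_swap S32) ab').
case cl : ((cg K1 == ca1 K1) || (cg K1 == cb1 K1)).
  exact: (three_class1 n12 n32 n13 S12 S32 ab ab' cl).
apply: (@three_class1 (cswap K1) (cswap K2) (cswap K3) n12 n32 n13
    (ctype_swap S12) (ctype_swap S32) ab' ab).
have [na nb] := config_col K1.
case: (eqVneq (cg (cswap K1)) (ca1 (cswap K1))) => //= g2.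
move/negbT: cl; rewrite negb_or => /andP[g1 g3].
apply/eqP; apply: (@I4_exhaust (ca1 K1) (ca2 K1) (cb1 K1)) => //.
rewrite /= !inE !negb_or na ab' ab cab1 nb.
by have := cab2 K1 => /= ->.
Qed.

End FourColours.

(** * Double counting of a relation *)

Lemma card_pairs (X Y : finType) (P : X -> Y -> bool) :
  #|[set q : X * Y | P q.1 q.2]| = \sum_x #|[set y | P x y]|.
Proof.
rewrite -sum1dep_card; under [RHS]eq_bigr do rewrite -sum1dep_card.
by rewrite pair_big_dep.
Qed.

Lemma exchange_card (X Y : finType) (P : X -> Y -> bool) :
  \sum_x #|[set y | P x y]| = \sum_y #|[set x | P x y]|.
Proof.
under eq_bigr do rewrite -sum1dep_card big_mkcond /=.
under [RHS]eq_bigr do rewrite -sum1dep_card big_mkcond /=.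
exact: exchange_big.
Qed.

(** * Degree counts, and the bound for any number of colours *)

Section Counting.
Variables (T : finType) (G : sgraph T) (r : nat) (c : {set T} -> 'I_r).
Hypothesis H : rainbow_2connected G c.
Hypothesis T_gt1 : 1 < #|T|.

Local Notation col x y := (c [set x; y]).
Local Notation deg := (deg G).

Lemma sum_deg_edges : \sum_x deg x <= 2 * #|edges G|.
Proof.
rewrite /deg -(card_pairs (fun x y => G x y)); apply: card_le2_imset => -[a b] [a' b'] [a2 b2].
rewrite !inE /= => _ _ _ e e' n1 n2 n3.
have E p q u v : [set p; q] = [set u; v] :> {set T} -> (p, q) = (u, v) \/ (p, q) = (v, u).
  move/setP => h; move: (h p) (h q) (h u) (h v); rewrite !inE !eqxx ?orbT /=.
  case: (eqVneq p u) => [->|pu] /=; case: (eqVneq q v) => [->|qv] /=; first by left.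
  - by case: (eqVneq q u) => [->|qu] //; case: (eqVneq u v) => // ->; left.
  - by case: (eqVneq p v) => [->|pv] //; case: (eqVneq v u) => // ->; left.
  by move=> /esym /eqP -> /esym; rewrite orbF => /eqP->; right.
case: (E _ _ _ _ e) => h1; first by rewrite h1 eqxx in n1.
case: (E _ _ _ _ e') => h2; first by rewrite h2 eqxx in n2.
by rewrite h1 h2 eqxx in n3.
Qed.

Lemma deg_gt1 x : 1 < deg x.
Proof.
case/card_gt1P: T_gt1 => a [b [_ _ ab]].
case: (eqVneq a x) => [ax|]; last by rewrite eq_sym => xa; apply: (deg_ge2 H xa).
by subst a; apply: (deg_ge2 H ab).
Qed.

(** The other neighbour of [u] when [u] has degree 2 and is adjacent to [v]; the default [u] only
    makes it total. *)
Definition oth (u v : T) := odflt u [pick x | G u x && (x != v)].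

Lemma nbr2_oth u v x : nbr2 G u v x -> oth u v = x.
Proof.
move=> N; rewrite /oth; case: pickP => /= [y /andP[Gy yv]|none].
  by case: (nbr2_in N Gy) => // e; rewrite e eqxx in yv.
by have := none x; rewrite (nbr2_r N) eq_sym N.1.
Qed.

Lemma othP u v : deg u = 2 -> G u v -> nbr2 G u v (oth u v).
Proof. by move=> du /(deg_nbr2 du)[x N]; rewrite (nbr2_oth N). Qed.

Definition arcs22 := [set q : T * T | [&& deg q.1 == 2, deg q.2 == 2 & G q.1 q.2]].

(** Fibres of [f] have at most two arcs by [arc_inj], and its values are pairs of distinct colours.
    The form with [+ 2 * r] avoids truncated subtraction. *)
Lemma card_arcs22 : #|arcs22| + 2 * r <= 2 * (r * r).
Proof.
pose f (q : T * T) := (col (oth q.1 q.2) q.1, col q.1 q.2).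
have h1 : #|arcs22| <= 2 * #|f @: arcs22|.
  apply: card_le2_imset => -[u v] [u' v'] [u2 v2]; rewrite !inE /f /=.
  move=> /and3P[/eqP du /eqP dv Guv] /and3P[/eqP du' /eqP dv' Guv'] /and3P[/eqP du2 /eqP dv2 Guv2].
  move=> [e1 e2] [e3 e4] n1 n2 n3.
  have Nu := othP du Guv; have Nu' := othP du' Guv'; have Nu2 := othP du2 Guv2.
  have Nv : nbr2 G v u (oth v u) by apply: othP; rewrite // adj_sym.
  have Nv' : nbr2 G v' u' (oth v' u') by apply: othP; rewrite // adj_sym.
  have Nv2 : nbr2 G v2 u2 (oth v2 u2) by apply: othP; rewrite // adj_sym.
  case: (arc_inj H Nu Nv Nu' Nv' e1 e2) => [] [h1 h2]; first by rewrite h1 h2 eqxx in n1.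
  case: (arc_inj H Nu2 Nv2 Nu' Nv' e3 e4) => [] [h3 h4]; first by rewrite h3 h4 eqxx in n2.
  by rewrite -h1 h3 -h2 h4 eqxx in n3.
have h2 : f @: arcs22 \subset
    [set q : 'I_r * 'I_r | [&& q.1 \in setT, q.2 \in setT & q.1 != q.2]].
  apply/subsetP => b /imsetP[[u v] uv ->]; move: uv.
  rewrite !inE /= => /and3P[/eqP du /eqP dv Guv].
  exact: (deg2_deg2_col H (othP du Guv) dv).
have := subset_leq_card h2; have := card_offdiag [set: 'I_r].
rewrite cardsT card_ord; move: h1.
set a := #|arcs22|; set b := #|f @: arcs22|; set d := #|[set q | _]|; move: (r * r) => rr.
lia.
Qed.

Let D2 := [set u | deg u == 2].
Let D3 := [set u | 2 < deg u].

Lemma degP x : deg x = 2 \/ 2 < deg x.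
Proof. by have := deg_gt1 x; lia. Qed.

Lemma card_degs : #|T| = #|D2| + #|D3|.
Proof.
rewrite -cardsUI (_ : D2 :&: D3 = set0) ?cards0 ?addn0.
  rewrite -cardsT; apply: eq_card => x; rewrite !inE.
  by case: (degP x) => [->|->]; rewrite ?eqxx ?orbT.
by apply/setP => x; rewrite !inE; case: eqP => // ->.
Qed.

Lemma sum_degs : \sum_x deg x = 2 * #|D2| + \sum_(x in D3) deg x.
Proof.
rewrite (bigID (mem D3)) /= addnC mulnC; congr (_ + _).
rewrite -sum_nat_const; apply: eq_big => [x|x]; rewrite !inE.
  by case: (degP x) => [->|h] //; rewrite h; case: eqP h => // ->.
by case: (degP x) => // ->.
Qed.

Lemma sum_D3 : 3 * #|D3| <= \sum_(x in D3) deg x.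
Proof. by rewrite mulnC -sum_nat_const; apply: leq_sum => x; rewrite inE. Qed.

(** An arc out of [D2] ends in [D2] or in [D3]; the sum counts all arcs into [D3]. *)
Lemma card_D2_arcs : 2 * #|D2| <= #|arcs22| + \sum_(x in D3) deg x.
Proof.
have -> : 2 * #|D2| = \sum_(x in D2) deg x.
  by rewrite mulnC -sum_nat_const; apply: eq_bigr => x; rewrite inE => /eqP.
have -> : \sum_(x in D2) deg x = #|[set q : T * T | (q.1 \in D2) && G q.1 q.2]|.
  rewrite (card_pairs (fun x y => (x \in D2) && G x y)) big_mkcond /=.
  apply: eq_bigr => x _; rewrite /deg; case: (x \in D2) => //=.
  by apply/esym/eqP; rewrite cards_eq0; apply/eqP/setP => y; rewrite !inE.
have -> : \sum_(x in D3) deg x = #|[set q : T * T | (q.2 \in D3) && G q.1 q.2]|.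
  rewrite (card_pairs (fun x y => (y \in D3) && G x y)) exchange_card big_mkcond /=.
  apply: eq_bigr => x _; rewrite /deg; case: (x \in D3) => //=.
    by apply: eq_card => y; rewrite !inE adj_sym.
  by apply/esym/eqP; rewrite cards_eq0; apply/eqP/setP => y; rewrite !inE.
apply: leq_trans (leq_card_setU _ _); apply/subset_leq_card/subsetP => -[x y].
rewrite !inE /= => /andP[-> ->]; rewrite !andbT /=.
by case: (degP y) => ->; rewrite ?orbT.
Qed.

(** With [e] edges and [n = a + b] vertices: [6 n <= 6 a + 2 s <= 5 a + 5 s / 2 + r (r - 1) <= 5 e +
    r (r - 1)]. *)
Lemma edges_lower_bound : 6 * #|T| + r <= 5 * #|edges G| + r * r.
Proof.
have := card_degs; have := sum_degs; have := sum_D3; have := card_D2_arcs.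
have := card_arcs22; have := sum_deg_edges.
set a := #|D2|; set b := #|D3|; set s := \sum_(x in D3) _; set t := \sum_x _.
lia.
Qed.

(** * Plain vertices and the charge they send *)

Definition monochromatic := [set u | (deg u == 2) &&
  [exists x, exists y, [&& G u x, G u y, x != y & col u x == col u y]]].

Lemma card_monochromatic : #|monochromatic| <= r.
Proof.
pose nb u := odflt u [pick x | G u x].
have nbP u x : G u x -> G u (nb u).
  by rewrite /nb; case: pickP => //= -> .
have M u : u \in monochromatic -> exists x, nbr2 G u (nb u) x /\ col u (nb u) = col u x.
  rewrite inE => /andP[/eqP du /existsP[x /existsP[y /and4P[Gx Gy xy /eqP e]]]].
  have N : nbr2 G u x y.
    have [y' N] := deg_nbr2 du Gx; case: (nbr2_in N Gy) => e'.
      by rewrite e' eqxx in xy.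
    by subst y'.
  by case: (nbr2_in N (nbP _ _ Gx)) => ->; [exists y | exists x; split; [apply: nbr2C|]].
rewrite -[X in _ <= X](card_ord r) -(card_in_imset (f := fun u => col u (nb u))) ?max_card //.
move=> u u' /M[x [N e]] /M[x' [N' e']] E.
by apply/esym/(mono_unique H N e (nbr2_deg N') (nbr2_l N')).
Qed.

Definition plain := [set u | [&& deg u == 2, [forall x, G u x ==> (2 < deg x)] &
  [forall x, forall y, [&& G u x, G u y & x != y] ==> (col u x != col u y)]]].

(** A vertex of degree 2 that is not plain is monochromatic or starts an arc of [arcs22]: at most
    [r + 2 r (r - 1)] vertices, 28 for [r = 4]. *)
Lemma card_D2_plain : #|D2| + r <= #|plain| + 2 * (r * r).
Proof.
have h : D2 \subset plain :|: (monochromatic :|: [set q.1 | q in arcs22]).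
  apply/subsetP => u; rewrite !inE => du; rewrite du /=.
  case h1 : [forall x, _] => /=; last first.
    move/negbT: h1; rewrite negb_forall => /existsP[x]; rewrite negb_imply => /andP[Gx dx].
    apply/orP; right; apply/imsetP; exists (u, x) => //; rewrite inE /= du Gx andbT /=.
    by case: (degP x) => [->|e] //; rewrite e in dx.
  case h2 : [forall x, _] => //=; apply/orP; left.
  move/negbT: h2; rewrite negb_forall => /existsP[x]; rewrite negb_forall => /existsP[y].
  rewrite negb_imply negbK => /andP[/and3P[Gx Gy xy] e].
  by apply/existsP; exists x; apply/existsP; exists y; rewrite Gx Gy xy.
have := subset_leq_card h; have := (leq_card_setU plain (monochromatic :|: [set q.1 | q in arcs22])).1.
have := (leq_card_setU monochromatic [set q.1 | q in arcs22]).1.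
have := leq_imset_card (fun q : T * T => q.1) arcs22.
have := card_monochromatic; have := card_arcs22.
by set a := #|D2|; set d := #|[set q.1 | q in arcs22]|; move: (r * r) => rr; lia.
Qed.

Definition triples := [set q : T * (T * T) | [&& deg q.1 == 3, G q.1 q.2.1, G q.1 q.2.2,
  q.2.1 \in plain, q.2.2 \in plain & q.2.1 != q.2.2]].

Lemma plain_deg u x : u \in plain -> G u x -> 2 < deg x.
Proof. by rewrite inE => /and3P[_ /forallP/(_ x)/implyP h _] /h. Qed.

Lemma plain_oth u x : u \in plain -> G u x ->
  nbr2 G u x (oth u x) /\ col x u != col u (oth u x).
Proof.
rewrite inE => /and3P[/eqP du _ /forallP/(_ x)/forallP/(_ (oth u x))/implyP h] Gx.
have N := othP du Gx; split=> //; rewrite colC; apply: h.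
by rewrite Gx (nbr2_r N) N.1.
Qed.

(** Four times the charge inequality at [v]. In degree [d >= 4] it follows from [2 d + 16 <= 6 d];
    in degree 3 with [k] plain neighbours there are [k (k - 1)] triples, and it reads
    [0 <= (k - 1) (k - 2)]. *)
Lemma triples_local v : v \in D3 ->
  2 * #|[set u | G v u && (u \in plain)]| + 16 <= 6 * deg v + #|[set p | (v, p) \in triples]|.
Proof.
rewrite inE => dv; set S := [set u | _].
have Sd : #|S| <= deg v.
  by apply/subset_leq_card/subsetP => u; rewrite !inE => /andP[].
case: (ltnP 3 (deg v)) => d4; first by lia.
have dv3 : deg v = 3 by lia.
have -> : [set p | (v, p) \in triples] = [set p : T * T | [&& p.1 \in S, p.2 \in S & p.1 != p.2]].
  apply/setP => -[x y]; rewrite !inE /= dv3 eqxx /=.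
  by case: (G v x) => //=; case: (G v y) => //=; rewrite ?andbF.
have := card_offdiag S; rewrite dv3 in Sd *.
by case: #|S| Sd => [|[|[|[|?]]]] //; lia.
Qed.

Lemma plain_count : 4 * #|plain| + 16 * #|D3| <= 6 * \sum_(x in D3) deg x + #|triples|.
Proof.
have e1 : 2 * #|plain| = \sum_(v in D3) #|[set u | G v u && (u \in plain)]|.
  have -> : 2 * #|plain| = \sum_(u in plain) deg u.
    by rewrite mulnC -sum_nat_const; apply: eq_bigr => u; rewrite inE => /and3P[/eqP].
  transitivity (\sum_v #|[set u | G v u && (u \in plain)]|).
    rewrite (exchange_card (fun v u => G v u && (u \in plain))) big_mkcond /=.
    apply: eq_bigr => u _; case: (u \in plain).
      by apply: eq_card => v; rewrite !inE andbT adj_sym.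
    by apply/esym/eqP; rewrite cards_eq0; apply/eqP/setP => v; rewrite !inE andbF.
  rewrite [RHS]big_mkcond /=; apply: eq_bigr => v _; case: ifPn => // vD.
  apply/eqP; rewrite cards_eq0; apply/eqP/setP => u; rewrite in_set in_set0.
  apply/negP => /andP[Gvu up]; case/negP: vD; rewrite inE.
  by apply: (plain_deg up); rewrite adj_sym.
have e2 : \sum_(v in D3) #|[set p | (v, p) \in triples]| <= #|triples|.
  have -> : #|triples| = \sum_v #|[set p | (v, p) \in triples]|.
    rewrite -(card_pairs (fun v p => (v, p) \in triples)).
    by apply: eq_card => -[v p]; rewrite !inE.
  by rewrite big_mkcond /=; apply: leq_sum => v _; case: ifP.
have : 2 * (2 * #|plain|) + #|D3| * 16 <=
    6 * (\sum_(v in D3) deg v) + \sum_(v in D3) #|[set p | (v, p) \in triples]|.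
  rewrite e1 !big_distrr /= -sum_nat_const -!big_split /=.
  by apply: leq_sum => v; apply: triples_local.
move: e2; set s := \sum_(x in D3) deg x; set t := \sum_(v in D3) _; lia.
Qed.

End Counting.

(** * The bound for four colours *)

Section FourColouring.
Variables (T : finType) (G : sgraph T) (c : {set T} -> 'I_4).
Hypothesis H : rainbow_2connected G c.
Hypothesis T_gt1 : 1 < #|T|.

Local Notation col x y := (c [set x; y]).

Definition triple_type (q : T * (T * T)) :=
  (col q.1 q.2.1, col q.2.1 (oth G q.2.1 q.1), col q.1 q.2.2, col q.2.2 (oth G q.2.2 q.1)).

Lemma triple_config q : q \in triples G c -> exists K : config G c,
  (cw K, (cu1 K, cu2 K)) = q /\ ctype K = triple_type q.
Proof.
case: q => w [u1 u2]; rewrite inE /= => /and5P[/eqP dw G1 G2 p1 /andP[p2 u12]].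
have [G1' G2'] : G u1 w /\ G u2 w by rewrite !(adj_sym G _ w).
have [N1 ab1] := plain_oth p1 G1'; have [N2 ab2] := plain_oth p2 G2'.
have [z Nw] : exists z, forall t, G w t = [|| t == u1, t == u2 | t == z].
  have : #|[set t | G w t] :\ u1 :\ u2| = 1.
    have := cardsD1 u1 [set t | G w t]; have := cardsD1 u2 ([set t | G w t] :\ u1).
    rewrite !inE G1 G2 eq_sym u12 /=; move: dw; rewrite /deg.
    by lia.
  move/eqP/cards1P => [z Ez]; exists z => t.
  move/setP: Ez => /(_ t); rewrite !inE => <-.
  case: (eqVneq t u1) => [->|_]; first by rewrite G1.
  by case: (eqVneq t u2) => [->|_]; first by rewrite G2.
have dw' : 2 < deg G w by rewrite dw.
exists (Config Nw N1 N2 u12 dw' (plain_deg p1 (nbr2_r N1)) (plain_deg p2 (nbr2_r N2)) ab1 ab2).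
by [].
Qed.

(** By [config_col], plain neighbours of a centre of degree 3 joined to it in the same colour
    coincide. So distinct triples of one type have distinct centres, as [no_three] requires. *)
Lemma triple_center q q' : q \in triples G c -> q' \in triples G c ->
  triple_type q = triple_type q' -> q.1 = q'.1 -> q = q'.
Proof.
case: q q' => w [u1 u2] [w' [u1' u2']] /= h h' E e; subst w'.
have D a b : a \in plain G c -> b \in plain G c -> G w a -> G w b -> deg G w = 3 ->
    col w a = col w b -> a = b.
  move=> pa pb Ga Gb dw e; apply/eqP; apply: contraT => ab.
  have [|K [[e1 e2 e3] _]] := @triple_config (w, (a, b)).
    by rewrite inE /= dw Ga Gb pa pb ab.
  by have [] := config_col H K; rewrite /ca1 /ca2 e1 e2 e3 e eqxx.
case: E => E1 _ E2 _.
move: h h'; rewrite !inE /= => /and5P[/eqP dw G1 G2 p1 /andP[p2 _]] /and5P[_ G1' G2' p1' /andP[p2' _]].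
have e1 : u1 = u1' by apply: D; rewrite // inE.
have e2 : u2 = u2' by apply: D; rewrite // inE.
by rewrite e1 e2.
Qed.

(** Proper colourings of the 4-cycle [a1 b1 b2 a2]; with 4 colours there are [3^4 + 3 = 84]. *)
Definition type_ok (t : 'I_4 * 'I_4 * 'I_4 * 'I_4) :=
  [&& t.1.1.1 != t.1.1.2, t.1.2 != t.2, t.1.1.1 != t.1.2 & t.1.1.2 != t.2].

Lemma card_type_ok : #|[set t | type_ok t]| <= 84.
Proof.
(* Written out so that [vm_compute] can evaluate the filtered list. *)
pose o4 : seq 'I_4 := [:: @Ordinal 4 0 isT; @Ordinal 4 1 isT; @Ordinal 4 2 isT; @Ordinal 4 3 isT].
have in4 (i : 'I_4) : i \in o4 by case: i => -[|[|[|[|?]]]].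
have [s sz sub] : exists2 s : seq ('I_4 * 'I_4 * 'I_4 * 'I_4),
    size s = 84 & forall t, type_ok t -> t \in s.
  exists [seq t <- [seq (p, d) | p <- [seq (p, d) | p <- [seq (a, d) | a <- o4, d <- o4],
                    d <- o4], d <- o4] | type_ok t]; first by vm_compute.
  move=> [[[x y] z] t]; rewrite mem_filter => ->.
  by apply: (allpairs_f pair) => //; apply: (allpairs_f pair) => //; apply: (allpairs_f pair).
rewrite -sz; apply: leq_trans (card_size s); apply/subset_leq_card/subsetP => t.
by rewrite inE; apply: sub.
Qed.

Lemma card_triples : #|triples G c| <= 168.
Proof.
apply: (@leq_trans (2 * #|triple_type @: triples G c|)); last first.
  have h : triple_type @: triples G c \subset [set t | type_ok t].
    apply/subsetP => _ /imsetP[q /triple_config[K [_ <-]] ->].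
    have [n1 n2] := config_col H K; rewrite inE /type_ok /= n1 n2.
    by have := cab1 K => -> ; have := cab2 K => ->.
  by have := subset_leq_card h; have := card_type_ok; lia.
apply: card_le2_imset => q1 q2 q3 h1 h2 h3 E12 E32 n12 n23 n31.
have [K1 [e1 t1]] := triple_config h1.
have [K2 [e2 t2]] := triple_config h2.
have [K3 [e3 t3]] := triple_config h3.
have N q q' : q \in triples G c -> q' \in triples G c -> triple_type q = triple_type q' ->
    q != q' -> q.1 != q'.1.
  by move=> h h' E; apply: contra_neq; apply: triple_center.
have c1 : cw K1 = q1.1 by rewrite -e1.
have c2 : cw K2 = q2.1 by rewrite -e2.
have c3 : cw K3 = q3.1 by rewrite -e3.
apply: (@no_three _ _ _ H K1 K2 K3); rewrite ?t1 ?t2 ?t3 ?c1 ?c2 ?c3 //; apply: N => //.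
- by rewrite eq_sym.
- by rewrite E12.
- by rewrite eq_sym.
Qed.

(** With [e] edges, [16 n <= 6 (2 a + s) + 4 * 28 + 168 <= 12 e + 280], within the required
    [72 = 3 * 24]. *)
Lemma edges_lower_bound4 : 4 * #|T| <= 3 * #|edges G| + 72.
Proof.
have := card_degs H T_gt1; have := sum_degs H T_gt1; have := sum_D3 G.
have := card_D2_plain H T_gt1; have := plain_count G c; have := card_triples.
have := sum_deg_edges G.
set a := #|[set u | deg G u == 2]|; set b := #|[set u | 2 < deg G u]|.
set s := \sum_(x in _) _; set t := \sum_x _.
lia.
Qed.

End FourColouring.

(** * Existence of minima, and enlarging the set of colours *)

Lemma is_min_ex (P : nat -> Prop) n : P n -> exists2 m, is_min P m & m <= n.
Proof.
elim/ltn_ind: n => n IH Pn.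
(* [P] is an arbitrary proposition, hence excluded middle. *)
case: (classic (exists2 k, P k & k < n)) => [[k Pk kn]|none].
  by have [m Hm mk] := IH k kn Pk; exists m => //; apply: leq_trans mk (ltnW kn).
exists n => //; split=> // k Pk; rewrite leqNgt; apply/negP => kn.
by apply: none; exists k.
Qed.

Lemma rainbow_widen (T : finType) (G : sgraph T) k r (c : {set T} -> 'I_k) (le_kr : k <= r) :
  rainbow_2connected G c -> rainbow_2connected G (fun e => widen_ord le_kr (c e)).
Proof.
move=> H x y xy; have [p [q [Rp Rq pq D]]] := H x y xy.
have E s z : path_colours (fun e => widen_ord le_kr (c e)) z s =
    map (widen_ord le_kr) (path_colours c z s).
  by elim: s z => //= a s IH z; rewrite -IH.
have W s : rainbow_path G c x y s -> rainbow_path G (fun e => widen_ord le_kr (c e)) x y s.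
  case/andP=> P U; rewrite /rainbow_path P E map_inj_uniq //.
  by move=> i j /(congr1 val) /= ij; apply: val_inj.
by exists p, q; split=> //; apply: W.
Qed.

(** * Two colours suffice for complete graphs on at least four vertices *)

Section CompleteGraph.
Variable n : nat.
Hypothesis n_gt3 : 3 < n.

Definition complete_adj : rel 'I_n := fun x y => x != y.

Lemma complete_sym : symmetric complete_adj.
Proof. by move=> x y; rewrite /complete_adj /= [x == y]eq_sym. Qed.

Lemma complete_irr : irreflexive complete_adj.
Proof. by move=> x; rewrite /complete_adj eqxx. Qed.

Definition complete := SGraph complete_sym complete_irr.

Lemma complete_two_connected : two_connected complete.
Proof.
split; first by rewrite card_ord; apply: ltnW.
  by move=> x y; case: (eqVneq x y) => [->|xy]; [apply: connect0 | apply: connect1].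
move=> v x y xv yv; case: (eqVneq x y) => [->|xy]; first exact: connect0.
by apply: connect1; apply/and3P.
Qed.

(* The edges of a Hamiltonian path form one colour class. *)
Definition path_colouring (e : {set 'I_n}) : 'I_2 :=
  inord [exists i : 'I_n, exists j : 'I_n, (j == i.+1 :> nat) && (e == [set i; j])].

Lemma path_colouringE (x y : 'I_n) :
  path_colouring [set x; y] = inord ((y == x.+1 :> nat) || (x == y.+1 :> nat)).
Proof.
congr inord; congr nat_of_bool; apply/existsP/orP.
  move=> [i /existsP[j /andP[/eqP ij /eqP e]]].
  have := set21 i j; have := set22 i j; rewrite -e !inE.
  by case/orP=> /eqP ej /orP[]/eqP ei; subst i j; rewrite ij ?eqxx; auto; lia.
case=> /eqP e; [exists x; apply/existsP; exists y | exists y; apply/existsP; exists x].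
  by rewrite e !eqxx.
by rewrite e eqxx setUC eqxx.
Qed.

Lemma complete_rainbow : rainbow_2connected complete path_colouring.
Proof.
(* The two paths will be the edge [x y] and [x z y], with [z] next to exactly one of [x], [y] on the
   Hamiltonian path: [y + 1] if it exists, else 1 if [x = 0] (here [n > 3] matters), else
   [x - 1]. *)
have key (x y : 'I_n) : x < y -> exists z : 'I_n, [/\ z != x, z != y &
    path_colouring [set x; z] != path_colouring [set z; y]].
  have inord01 (a b : bool) : a != b -> inord a != inord b :> 'I_2.
    by move=> ab; rewrite -val_eqE /= !inordK; case: a b ab => -[].
  move=> xy; have yn := ltn_ord y; have xn := ltn_ord x.
  case: (ltnP y.+1 n) => h.
    exists (Ordinal h); rewrite -!val_eqE /= !path_colouringE /=.
    by split; try lia; apply: inord01; lia.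
  case: (posnP x) => x0.
    have h1 : 1 < n by lia.
    exists (Ordinal h1); rewrite -!val_eqE /= !path_colouringE /=.
    by split; try lia; apply: inord01; lia.
  have h1 : x.-1 < n by lia.
  exists (Ordinal h1); rewrite -!val_eqE /= !path_colouringE /=.
  by split; try lia; apply: inord01; lia.
move=> x y xy.
have [z [zx zy zc]] : exists z : 'I_n, [/\ z != x, z != y &
    path_colouring [set x; z] != path_colouring [set z; y]].
  case: (ltngtP x y) => [|h|/val_inj e]; first exact: key.
    by have [z [zy zx zc]] := key _ _ h; exists z; split=> //; rewrite eq_sym ![[set z; _]]setUC [[set x; _]]setUC.
  by rewrite e eqxx in xy.
exists [:: y], [:: z; y]; split=> //.
- by rewrite /rainbow_path /is_path /= /complete_adj !inE xy eqxx.
- by rewrite /rainbow_path /is_path /= /complete_adj !inE eqxx negb_or xy zy eq_sym zx zc.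
- by rewrite eqseq_cons andbF.
- by rewrite disjoint_has.
Qed.

End CompleteGraph.

(** * Existence of the minimum and transfer of the edge bounds *)

Lemma t2_bound n r (B : nat -> Prop) : 3 < n -> 2 <= r ->
  (forall (T : finType) (G : sgraph T) (c : {set T} -> 'I_r),
     #|T| = n -> rainbow_2connected G c -> B #|edges G|) ->
  exists2 t, is_t2 n r t & B t.
Proof.
move=> n3 r2 HB.
(* The complete graph shows that some graph is admissible, so the minimum exists. *)
have [k rck kr] : exists2 k, is_rc2 (complete n) k & k <= 2.
  by apply: is_min_ex; exists (@path_colouring n); apply: complete_rainbow.
have [|t Ht _] := @is_min_ex (fun e => exists (T : finType) (G : sgraph T),
            [/\ #|T| = n, two_connected G,
                (exists2 k, is_rc2 G k & k <= r) & #|edges G| = e]) #|edges (complete n)|.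
  exists 'I_n, (complete n); split=> //; first exact: card_ord.
    exact: complete_two_connected.
  by exists k => //; apply: leq_trans kr r2.
exists t => //; have [[T [G [Tn _ [k' [[c Hc] _] le_k] <-]]] _] := Ht.
exact: HB Tn (rainbow_widen le_k Hc).
Qed.

Local Open Scope ring_scope.

Theorem theorem3p1 :
  (forall n r : nat, r = 3%N \/ r = 4%N -> (18 <= n)%N ->
     exists2 t : nat, is_t2 n r t & 4 / 3 * n%:R - 24 <= t%:R :> rat)
  /\
  (forall n r : nat, (5 <= r <= n - 1)%N ->
     1 / 6 * (r%:R * (r%:R - 1)) < n%:R :> rat ->
     exists2 t : nat, is_t2 n r t &
       6 / 5 * n%:R - 1 / 5 * (r%:R * (r%:R - 1)) <= t%:R :> rat).
Proof.
split=> n r.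
  move=> r34 n18; apply: t2_bound; [lia | lia |] => T G c Tn Hc.
  have r4 : (r <= 4)%N by lia.
  (* Three colours are regarded as four. *)
  have := edges_lower_bound4 (rainbow_widen r4 Hc).
  rewrite Tn => /(_ (leq_trans (isT : 1 < 18)%N n18)).
  by rewrite -(ler_nat rat) natrD !natrM => h; lra.
move=> /andP[r5 rn] _; apply: t2_bound; [lia | lia |] => T G c Tn Hc.
have := edges_lower_bound Hc; rewrite Tn => /(_ ltac:(lia)).
by rewrite -(ler_nat rat) !natrD !natrM => h; lra.
Qed.
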